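(* For $i,j=1,\ldots,n_d$, $$[G_j]_{t_i^d}=\delta_{ij}$$ (Kronecker delta). Moreover, $G_j$ is Lipschitz continuous on every closed subarc of $\Gamma$ not containing $t_j^d$ and belongs to $X_\sigma$ for every $0<\sigma<1$.
   Context: **Contour.** $\Gamma\subset\mathbb C$ is a simple, closed, positively oriented contour of class $C^2$ with a regular $C^2$, $2\pi$-periodic parametrization $\gamma:\mathbb R\to\Gamma$ (so $\gamma(\theta+2\pi)=\gamma(\theta)$, $\gamma'(\theta)\ne0$, $\gamma$ injective on $[0,2\pi)$). $\mathcal D=\{t_1^d,\ldots,t_{n_d}^d\}\subset\Gamma$, $n_d\ge1$, is a set of distinct points, $t_j^d=\gamma(\theta_j^d)$ with $0<\theta_1^d<\cdots<\theta_{n_d}^d<2\pi$; the point $t_*=\gamma(0)=\gamma(2\pi)\notin\mathcal D$ is the cut. The continuity arcs are the $n_d$ open arcs of $\Gamma\setminus\mathcal D$. For a function $v$ with one-sided limits, $v(t_j^d\pm0)$ denote the limits along the orientation ($-$: incoming, $+$: outgoing), $[v]_{t_j^d}:=v(t_j^d+0)-v(t_j^d-0)$, and functions are represented by incoming values $v(t_j^d)=v(t_j^d-0)$. **Spaces.** For $0<\sigma<1$, $X_\sigma=PH_\sigma(\Gamma,\mathcal D)$ is the space of complex functions that are $\sigma$-Hölder on every continuity arc and have finite lateral limits at all points of $\mathcal D$, with norm $\|v\|_{X_\sigma}=\max_I(\|v\|_{\infty,I}+[v]_{\sigma,I})$, the maximum over the continuity arcs $I$; here $\overline I^{\,\ell}$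 is $I$ completed by its two endpoints carrying the lateral values, $\|v\|_{\infty,I}=\sup_{\overline I^{\,\ell}}|v|$ and $[v]_{\sigma,I}=\sup_{t\ne s\in\overline I^{\,\ell}}|v(t)-v(s)|/|t-s|^\sigma$. If $n_d=1$, the distance $|t-s|$ in this seminorm is understood as the distance along the (single) completed arc. **Generators.** For $0\le\theta<2\pi$: $H_j(\gamma(\theta))=0$ if $0\le\theta\le\theta_j^d$ and $=1$ if $\theta_j^d<\theta<2\pi$; $R(\gamma(\theta))=\theta/(2\pi)$; $G_j:=H_j-R$. *)

(* Defs.v *)
From Stdlib Require Import Reals Lra Lia Arith ClassicalEpsilon.
From Coquelicot Require Import Coquelicot.

Open Scope R_scope.

Definition curve_deriv (gamma : R -> C) (t : R) : C :=
  (Derive (fun s => Re (gamma s)) t, Derive (fun s => Im (gamma s)) t).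

Definition C2_fun (f : R -> R) : Prop :=
  forall (k : nat) (t : R),
    (k <= 2)%nat -> ex_derive_n f k t /\ continuous (Derive_n f k) t.

Definition trace (gamma : R -> C) (z : C) : Prop := exists t : R, z = gamma t.

Definition joined_off (gamma : R -> C) (z w : C) : Prop :=
  exists p : R -> C,
    (forall t, continuous p t) /\ p 0 = z /\ p 1 = w /\
    (forall t, 0 <= t <= 1 -> ~ trace gamma (p t)).

(* The bounded component of the complement.  The complement is open, so its
   connected components are its path components. *)
Definition interior_point (gamma : R -> C) (z : C) : Prop :=
  ~ trace gamma z /\
  exists M : R, forall w, joined_off gamma z w -> Cmod w <= M.

(* Winding number +1 about the points enclosed by the curve:
   the contour integral of 1/(zeta - z) equals 2 i PI. *)
Definition positively_oriented (gamma : R -> C) : Prop :=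
  forall z, interior_point gamma z ->
    is_RInt (V := C_R_NormedModule)
      (fun t => Cdiv (curve_deriv gamma t) (Cminus (gamma t) z))
      0 (2 * PI) (0, 2 * PI).

Record contour (gamma : R -> C) : Prop := {
  contour_periodic : forall t, gamma (t + 2 * PI) = gamma t;
  contour_C2 : C2_fun (fun t => Re (gamma t)) /\ C2_fun (fun t => Im (gamma t));
  contour_regular : forall t, curve_deriv gamma t <> RtoC 0;
  contour_simple : forall s t,
    0 <= s < 2 * PI -> 0 <= t < 2 * PI -> gamma s = gamma t -> s = t;
  contour_oriented : positively_oriented gamma
}.

(* The discontinuity points are gamma (th j) for j = 1, ..., n;
   the values of th at other indices are irrelevant. *)
Record disc_angles (n : nat) (th : nat -> R) : Prop := {
  disc_nonempty : (1 <= n)%nat;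
  disc_range : forall j, (1 <= j <= n)%nat -> 0 < th j < 2 * PI;
  disc_increasing : forall i j,
    (1 <= i)%nat -> (i < j)%nat -> (j <= n)%nat -> th i < th j
}.

(* Functions on the contour are maps C -> C, of which only the values on
   [trace gamma] matter. *)

(* v (gamma theta - 0) = l *)
Definition lim_incoming (gamma : R -> C) (v : C -> C) (theta : R) (l : C) : Prop :=
  filterlim (fun s => v (gamma s)) (at_left theta) (locally l).

(* v (gamma theta + 0) = l *)
Definition lim_outgoing (gamma : R -> C) (v : C -> C) (theta : R) (l : C) : Prop :=
  filterlim (fun s => v (gamma s)) (at_right theta) (locally l).

(* Both lateral limits of v at gamma theta exist and [v] = d there. *)
Definition has_jump (gamma : R -> C) (v : C -> C) (theta : R) (d : C) : Prop :=
  exists lm lp : C,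
    lim_incoming gamma v theta lm /\ lim_outgoing gamma v theta lp /\
    d = Cminus lp lm.

(* The k-th continuity arc, k = 1, ..., n, is the image of the open interval
   (th k, arc_end n th k); the last arc passes through the cut. *)
Definition arc_end (n : nat) (th : nat -> R) (k : nat) : R :=
  if Nat.eq_dec k n then th 1%nat + 2 * PI else th (S k).

(* Points of a completed arc are given by their parameters, so that the two
   endpoints stay distinct when n = 1. *)
Definition arc_dist (gamma : R -> C) (n : nat) (s t : R) : R :=
  if Nat.eq_dec n 1
  then Rabs (RInt (fun u => Cmod (curve_deriv gamma u)) s t)
  else Cmod (Cminus (gamma s) (gamma t)).

(* l is the value of v at the point of parameter s of the completed k-th arc. *)
Definition completed_value (gamma : R -> C) (n : nat) (th : nat -> R)
    (v : C -> C) (k : nat) (s : R) (l : C) : Prop :=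
  (th k < s < arc_end n th k /\ l = v (gamma s)) \/
  (s = th k /\ lim_outgoing gamma v (th k) l) \/
  (s = arc_end n th k /\ lim_incoming gamma v (arc_end n th k) l).

Definition arc_sup (gamma : R -> C) (n : nat) (th : nat -> R)
    (v : C -> C) (k : nat) : Rbar :=
  Lub_Rbar (fun x => exists s l,
    completed_value gamma n th v k s l /\ x = Cmod l).

Definition arc_holder (gamma : R -> C) (n : nat) (th : nat -> R)
    (sigma : R) (v : C -> C) (k : nat) : Rbar :=
  Lub_Rbar (fun x => exists s t ls lt,
    completed_value gamma n th v k s ls /\
    completed_value gamma n th v k t lt /\
    s <> t /\
    x = Cmod (Cminus ls lt) / Rpower (arc_dist gamma n s t) sigma).

Definition PH_norm (gamma : R -> C) (n : nat) (th : nat -> R)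
    (sigma : R) (v : C -> C) : Rbar :=
  Rbar_lub (fun x => exists k, (1 <= k <= n)%nat /\
    x = Rbar_plus (arc_sup gamma n th v k) (arc_holder gamma n th sigma v k)).

Record in_PH (gamma : R -> C) (n : nat) (th : nat -> R)
    (sigma : R) (v : C -> C) : Prop := {
  PH_holder : forall k, (1 <= k <= n)%nat ->
    exists M : R, forall s t,
      th k < s < arc_end n th k -> th k < t < arc_end n th k -> s <> t ->
      Cmod (Cminus (v (gamma s)) (v (gamma t)))
        <= M * Rpower (arc_dist gamma n s t) sigma;
  (* the value at a discontinuity point is the incoming one *)
  PH_incoming : forall j, (1 <= j <= n)%nat ->
    lim_incoming gamma v (th j) (v (gamma (th j)));
  PH_outgoing : forall j, (1 <= j <= n)%nat ->
    exists l : C, lim_outgoing gamma v (th j) l;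
  PH_norm_finite : is_finite (PH_norm gamma n th sigma v)
}.

(* The parameter in [0, 2 PI) of a point of the contour; arbitrary elsewhere. *)
Definition angle (gamma : R -> C) (z : C) : R :=
  epsilon (inhabits 0) (fun t => 0 <= t < 2 * PI /\ gamma t = z).

Definition Hgen (gamma : R -> C) (th : nat -> R) (j : nat) (z : C) : C :=
  if Rle_dec (angle gamma z) (th j) then RtoC 0 else RtoC 1.

Definition Rgen (gamma : R -> C) (z : C) : C :=
  RtoC (angle gamma z / (2 * PI)).

Definition Ggen (gamma : R -> C) (th : nat -> R) (j : nat) (z : C) : C :=
  Cminus (Hgen gamma th j z) (Rgen gamma z).

Lemma angle_gamma (gamma : R -> C) (t : R) :
  contour gamma -> 0 <= t < 2 * PI -> angle gamma (gamma t) = t.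
Proof.
intros Hg Ht.
destruct (epsilon_spec (inhabits 0)
  (fun s => 0 <= s < 2 * PI /\ gamma s = gamma t)) as [H1 H2].
{ now exists t. }
now apply (contour_simple _ Hg).
Qed.

(* Arcs may pass through the cut, whence the arbitrary real parameters. *)
Definition closed_subarc (gamma : R -> C) (A : C -> Prop) : Prop :=
  exists a b : R, a <= b <= a + 2 * PI /\
    forall z, A z <-> exists t, a <= t <= b /\ z = gamma t.

Definition lipschitz_on (A : C -> Prop) (f : C -> C) : Prop :=
  exists L : R, forall z w, A z -> A w ->
    Cmod (Cminus (f z) (f w)) <= L * Cmod (Cminus z w).

Definition kron (i j : nat) : C :=
  if Nat.eq_dec i j then RtoC 1 else RtoC 0.

(* Main.v *)
(** Along the parametrization, [G_j] is affine with slope [-1/(2 PI)] between two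
    consecutive passages through [t_j]; this gives the jumps at once.  The
    regularity statements follow from the chord-arc bound
    [|s - t| <= L |gamma s - gamma t|], valid on parameter intervals shorter than
    a period: near the diagonal it comes from [gamma' <> 0] and the mean value
    theorem, away from it from injectivity, and compactness makes it uniform.
    When there is a single discontinuity the arc length replaces the chord, and
    the bound follows from [|gamma'|] being bounded below. *)
Require Import Defs.
From Stdlib Require Import Reals ZArith Lra Lia ClassicalEpsilon.
From Coquelicot Require Import Coquelicot.

Open Scope R_scope.

(** * Shifts by whole periods and injectivity *)

Lemma shift_into_period (p x : R) :
  exists k : Z, p < x - IZR k * (2 * PI) <= p + 2 * PI.
Proof.
assert (HP := PI_RGT_0).
destruct (archimed ((p - x) / (2 * PI))) as [H1 H2].
(* [up] exceeds its argument strictly and by at most 1, hence the open left end and the closed right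
   end. *)
exists (- up ((p - x) / (2 * PI)))%Z.
rewrite opp_IZR.
set (k := IZR (up ((p - x) / (2 * PI)))) in *.
assert (E : (p - x) / (2 * PI) * (2 * PI) = p - x) by (field; lra).
set (q := (p - x) / (2 * PI)) in *.
split; nra.
Qed.

Lemma Cmod_RtoC_minus (a b : R) : Cmod (Cminus (RtoC a) (RtoC b)) = Rabs (a - b).
Proof. now rewrite <- RtoC_minus, Cmod_R. Qed.

Lemma Cmod_ge_Re (z : C) : Rabs (Re z) <= Cmod z.
Proof. eapply Rle_trans; [apply Rmax_l | apply Rmax_Cmod]. Qed.

Lemma Cmod_ge_Im (z : C) : Rabs (Im z) <= Cmod z.
Proof. eapply Rle_trans; [apply Rmax_r | apply Rmax_Cmod]. Qed.

Lemma contour_periodic_Z (gamma : R -> C) (Hg : contour gamma) (k : Z) (t : R) :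
  gamma (t + IZR k * (2 * PI)) = gamma t.
Proof.
revert t.
assert (HN : forall m t, gamma (t + INR m * (2 * PI)) = gamma t).
{ induction m as [|m IH]; intros t.
  - f_equal; simpl; ring.
  - rewrite S_INR.
    replace (t + (INR m + 1) * (2 * PI)) with ((t + INR m * (2 * PI)) + 2 * PI) by ring.
    now rewrite (contour_periodic _ Hg). }
intros t.
destruct (Z.le_ge_cases 0 k) as [Hk|Hk].
- rewrite <- (Z2Nat.id k Hk), <- INR_IZR_INZ. apply HN.
- rewrite <- (HN (Z.to_nat (- k))).
  f_equal. rewrite INR_IZR_INZ, Z2Nat.id by lia. rewrite opp_IZR. ring.
Qed.

(** Shifted into the base period, both parameters coincide by simplicity, so [s] and [t] differ by a
    multiple of the period; being less than a period apart, they are equal. *)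
Lemma contour_injective (gamma : R -> C) (Hg : contour gamma) (s t : R) :
  Rabs (s - t) < 2 * PI -> gamma s = gamma t -> s = t.
Proof.
intros Hst E.
assert (HP := PI_RGT_0).
(* [shift_into_period] lands in a half-open interval closed on the right. *)
destruct (shift_into_period 0 (- s)) as [k Hk].
destruct (shift_into_period 0 (- t)) as [l Hl].
(* [s + IZR k * (2 * PI)] lies in [-2 PI, 0); one more period takes it to [0, 2 PI). *)
assert (Hs : gamma (s + IZR (k + 1) * (2 * PI)) = gamma s)
  by now apply contour_periodic_Z.
assert (Ht : gamma (t + IZR (l + 1) * (2 * PI)) = gamma t)
  by now apply contour_periodic_Z.
rewrite plus_IZR in Hs, Ht.
assert (D : s + (IZR k + 1) * (2 * PI) = t + (IZR l + 1) * (2 * PI)).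
{ apply (contour_simple _ Hg); try lra. congruence. }
apply Rabs_def2 in Hst.
assert (k = l).
{ enough (-1 < k - l < 1)%Z by lia.
  split; apply lt_IZR; rewrite minus_IZR; nra. }
subst l. lra.
Qed.

(** * The chord-arc bound *)

(** A single [d] is both radius and constant, so that one gauge on pairs suffices for compactness
    and its lower bound is the global constant. *)
Definition locally_chord_arc (gamma : R -> C) (u v : R) (d : R) : Prop :=
  forall s t, Rabs (s - u) < d -> Rabs (t - v) < d ->
    d * Rabs (s - t) <= Cmod (Cminus (gamma s) (gamma t)).

Lemma C2_fun_ex_derive (f : R -> R) (t : R) : C2_fun f -> ex_derive f t.
Proof. intros H. exact (proj1 (H 1%nat t ltac:(lia))). Qed.

Lemma C2_fun_continuous (f : R -> R) (t : R) : C2_fun f -> continuous f t.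
Proof. intros H. exact (proj2 (H 0%nat t ltac:(lia))). Qed.

Lemma C2_fun_continuous_Derive (f : R -> R) (t : R) :
  C2_fun f -> continuous (Derive f) t.
Proof. intros H. exact (proj2 (H 1%nat t ltac:(lia))). Qed.

Lemma continuous_eps (f : R -> R) (x : R) : continuous f x ->
  forall e, 0 < e -> exists d, 0 < d /\ forall y, Rabs (y - x) < d -> Rabs (f y - f x) < e.
Proof.
intros H e He.
destruct (proj1 (filterlim_locally f (f x)) H (mkposreal e He)) as [d Hd].
exists d; split; [apply cond_pos|]. exact Hd.
Qed.

Lemma C2_fun_expanding (f : R -> R) (u : R) : C2_fun f -> Derive f u <> 0 ->
  exists d, 0 < d /\ forall s t, Rabs (s - u) < d -> Rabs (t - u) < d ->
    d * Rabs (s - t) <= Rabs (f s - f t).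
Proof.
intros Hf Hu.
assert (Hp := Rabs_pos_lt _ Hu).
destruct (continuous_eps _ u (C2_fun_continuous_Derive f u Hf) (Rabs (Derive f u) / 2))
  as [d [Hd H]]; [lra|].
(* Shrinking the witness weakens both requirements, so the minimum of an admissible radius and an
   admissible slope bound serves as both. *)
exists (Rmin d (Rabs (Derive f u) / 2)); split; [apply Rmin_pos; lra|].
intros s t Hs Ht.
assert (Hs' := Rlt_le_trans _ _ _ Hs (Rmin_l _ _)).
assert (Ht' := Rlt_le_trans _ _ _ Ht (Rmin_l _ _)).
destruct (MVT_gen f t s (Derive f)) as [c [Hc E]].
- intros x _. apply Derive_correct. now apply C2_fun_ex_derive.
- intros x _. apply continuity_pt_filterlim. now apply C2_fun_continuous.
- rewrite E, Rabs_mult.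
  apply Rmult_le_compat_r; [apply Rabs_pos|].
  eapply Rle_trans; [apply Rmin_r|].
  assert (Hcd : Rabs (c - u) < d).
  { apply Rabs_def2 in Hs'. apply Rabs_def2 in Ht'. apply Rabs_def1;
    unfold Rmin, Rmax in Hc; destruct (Rle_dec t s); lra. }
  specialize (H c Hcd).
  assert (T := Rabs_triang_inv (Derive f u) (Derive f c)).
  rewrite Rabs_minus_sym in H. lra.
Qed.

(** Regularity makes the derivative of one coordinate nonzero, and the increment of a coordinate
    never exceeds the chord. *)
Lemma chord_arc_diagonal (gamma : R -> C) (Hg : contour gamma) (u : R) :
  exists d, 0 < d /\ locally_chord_arc gamma u u d.
Proof.
destruct (contour_C2 _ Hg) as [HX HY].
destruct (Req_dec (Derive (fun s => Re (gamma s)) u) 0) as [E1|N1].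
- destruct (Req_dec (Derive (fun s => Im (gamma s)) u) 0) as [E2|N2].
  + exfalso. apply (contour_regular _ Hg u). unfold curve_deriv.
    now rewrite E1, E2.
  + destruct (C2_fun_expanding _ u HY N2) as [d [Hd H]].
    exists d; split; [easy|]. intros s t Hs Ht.
    eapply Rle_trans; [now apply H|].
    exact (Cmod_ge_Im (Cminus (gamma s) (gamma t))).
- destruct (C2_fun_expanding _ u HX N1) as [d [Hd H]].
  exists d; split; [easy|]. intros s t Hs Ht.
  eapply Rle_trans; [now apply H|].
  exact (Cmod_ge_Re (Cminus (gamma s) (gamma t))).
Qed.

Lemma chord_arc_separated (f : R -> R) (u v : R) :
  continuous f u -> continuous f v -> f u <> f v ->
  exists d, 0 < d /\ forall s t, Rabs (s - u) < d -> Rabs (t - v) < d ->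
    d * Rabs (s - t) <= Rabs (f s - f t).
Proof.
intros Cu Cv N.
set (m := Rabs (f u - f v)).
assert (Hm : 0 < m) by (apply Rabs_pos_lt; lra).
destruct (continuous_eps f u Cu (m / 4)) as [d1 [Hd1 H1]]; [lra|].
destruct (continuous_eps f v Cv (m / 4)) as [d2 [Hd2 H2]]; [lra|].
(* [B] bounds |s - t| once [s] and [t] are within 1 of [u] and [v]; two errors of [m / 4] leave a
   gap of [m / 2], whence the constant [m / 2 / B]. *)
set (B := Rabs (u - v) + 2).
assert (HB : 0 < B) by (unfold B; assert (T := Rabs_pos (u - v)); lra).
assert (Hq : 0 < m / 2 / B) by (apply Rdiv_lt_0_compat; lra).
exists (Rmin (Rmin d1 d2) (Rmin 1 (m / 2 / B))); split;
  [repeat apply Rmin_pos; lra|].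
set (d := Rmin _ _).
assert (L1 : d <= d1) by (eapply Rle_trans; [apply Rmin_l|apply Rmin_l]).
assert (L2 : d <= d2) by (eapply Rle_trans; [apply Rmin_l|apply Rmin_r]).
assert (L3 : d <= 1) by (eapply Rle_trans; [apply Rmin_r|apply Rmin_l]).
assert (L4 : d <= m / 2 / B) by (eapply Rle_trans; [apply Rmin_r|apply Rmin_r]).
assert (L0 : 0 < d) by (repeat apply Rmin_pos; lra).
intros s t Hs Ht.
assert (A1 := H1 s ltac:(lra)). assert (A2 := H2 t ltac:(lra)).
assert (Hst : Rabs (s - t) <= B).
{ unfold B. assert (T := Rle_abs (u - v)).
  assert (T' := Rle_abs (- (u - v))). rewrite Rabs_Ropp in T'.
  apply Rabs_def2 in Hs. apply Rabs_def2 in Ht. apply Rabs_le. lra. }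
apply Rle_trans with (m / 2).
- apply Rle_trans with (m / 2 / B * B); [|right; field; lra].
  apply Rmult_le_compat; try lra. apply Rabs_pos.
- unfold m.
  assert (T : Rabs (f u - f v) <= Rabs (f u - f s) + Rabs (f s - f t) + Rabs (f t - f v)).
  { replace (f u - f v) with ((f u - f s) + (f s - f t) + (f t - f v)) by ring.
    eapply Rle_trans; [apply Rabs_triang|]. apply Rplus_le_compat_r, Rabs_triang. }
  rewrite (Rabs_minus_sym (f u) (f s)) in T. fold m in T. fold m. lra.
Qed.

Lemma chord_arc_local (gamma : R -> C) (Hg : contour gamma) (u v : R) :
  Rabs (u - v) < 2 * PI -> exists d, 0 < d /\ locally_chord_arc gamma u v d.
Proof.
intros Huv.
destruct (Req_dec u v) as [<-|N]; [now apply chord_arc_diagonal|].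
destruct (contour_C2 _ Hg) as [HX HY].
destruct (Req_dec (Re (gamma u)) (Re (gamma v))) as [E1|N1].
- destruct (Req_dec (Im (gamma u)) (Im (gamma v))) as [E2|N2].
  + exfalso. apply N, (contour_injective _ Hg); [easy|].
    destruct (gamma u), (gamma v). simpl in *. congruence.
  + destruct (chord_arc_separated (fun s => Im (gamma s)) u v) as [d [Hd H]];
      try now apply C2_fun_continuous. { exact N2. }
    exists d; split; [easy|]. intros s t Hs Ht.
    eapply Rle_trans; [now apply H|].
    exact (Cmod_ge_Im (Cminus (gamma s) (gamma t))).
- destruct (chord_arc_separated (fun s => Re (gamma s)) u v) as [d [Hd H]];
    try now apply C2_fun_continuous. { exact N1. }
  exists d; split; [easy|]. intros s t Hs Ht.
  eapply Rle_trans; [now apply H|].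
  exact (Cmod_ge_Re (Cminus (gamma s) (gamma t))).
Qed.

Lemma chord_arc (gamma : R -> C) (Hg : contour gamma) (a b : R) :
  b - a < 2 * PI ->
  exists c, 0 < c /\ forall s t, a <= s <= b -> a <= t <= b ->
    c * Rabs (s - t) <= Cmod (Cminus (gamma s) (gamma t)).
Proof.
intros Hab.
(* The gauge has to be defined on all pairs, so membership in the square goes under the existential;
   pairs a period or more apart get the dummy value 1. *)
assert (Hloc : forall u v, exists d : posreal,
  a <= u <= b -> a <= v <= b -> locally_chord_arc gamma u v d).
{ intros u v.
  destruct (Rlt_dec (Rabs (u - v)) (2 * PI)) as [H|H].
  - destruct (chord_arc_local _ Hg u v H) as [d [Hd Hl]].
    exists (mkposreal d Hd). now intros _ _.
  - exists (mkposreal 1 Rlt_0_1). intros Hu Hv. exfalso. apply H.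
    apply Rabs_def1; lra. }
set (delta u v := proj1_sig (constructive_indefinite_description _ (Hloc u v))).
assert (Hdelta : forall u v, a <= u <= b -> a <= v <= b ->
  locally_chord_arc gamma u v (delta u v)).
{ intros u v. exact (proj2_sig (constructive_indefinite_description _ (Hloc u v))). }
destruct (compactness_value_2d a b a b delta) as [d Hd].
exists d; split; [apply cond_pos|].
intros s t Hs Ht.
(* Compactness yields the nearby centre only under a double negation, so the inequality is decided
   first and its failure refuted. *)
destruct (Rle_dec (d * Rabs (s - t)) (Cmod (Cminus (gamma s) (gamma t)))) as [H|H];
  [easy|exfalso].
apply (Hd s t Hs Ht). intros [u [v [Hu [Hv [Hsu [Htv Hle]]]]]]. apply H.
eapply Rle_trans; [|apply (Hdelta u v Hu Hv s t Hsu Htv)].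
apply Rmult_le_compat_r; [apply Rabs_pos|easy].
Qed.

(** * Lower bound for the arc length *)

Lemma continuous_speed (gamma : R -> C) (Hg : contour gamma) (t : R) :
  continuous (fun u => Cmod (curve_deriv gamma u)) t.
Proof.
destruct (contour_C2 _ Hg) as [HX HY].
assert (CX := C2_fun_continuous_Derive _ t HX).
assert (CY := C2_fun_continuous_Derive _ t HY).
unfold Cmod, curve_deriv; simpl.
apply (continuous_comp (fun u => _) sqrt); [|apply continuous_sqrt].
apply (continuous_plus (V := R_NormedModule)); repeat apply (continuous_mult (K := R_AbsRing));
  try easy; apply continuous_const.
Qed.

Lemma arc_length_lower_bound (gamma : R -> C) (Hg : contour gamma) (a b : R) :
  a <= b ->
  exists c, 0 < c /\ forall s t, a <= s <= b -> a <= t <= b ->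
    c * Rabs (s - t) <= Rabs (RInt (fun u => Cmod (curve_deriv gamma u)) s t).
Proof.
intros Hab.
set (f := fun u => Cmod (curve_deriv gamma u)).
destruct (continuity_ab_min f a b Hab) as [m [Hm Hmab]].
{ intros c _. apply continuity_pt_filterlim. now apply continuous_speed. }
exists (f m); split; [apply Cmod_gt_0, (contour_regular _ Hg)|].
assert (Hint : forall s t, ex_RInt f s t).
{ intros s t. apply (ex_RInt_continuous (V := R_CompleteNormedModule)).
  intros; now apply continuous_speed. }
assert (Hord : forall s t, a <= s <= b -> a <= t <= b -> s <= t ->
  f m * Rabs (s - t) <= Rabs (RInt f s t)).
{ intros s t Hs Ht Hst.
  eapply Rle_trans; [|apply Rle_abs].
  replace (f m * Rabs (s - t)) with (RInt (fun _ => f m) s t).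
  - apply RInt_le; [easy|apply ex_RInt_const|apply Hint|].
    intros x Hx. apply Hm. lra.
  - rewrite RInt_const, Rabs_minus_sym, Rabs_pos_eq by lra.
    unfold scal; simpl; unfold mult; simpl. ring. }
intros s t Hs Ht.
destruct (Rle_dec s t) as [H|H]; [now apply Hord|].
rewrite <- (opp_RInt_swap f t s) by apply Hint.
change (f m * Rabs (s - t) <= Rabs (- RInt f t s)).
rewrite Rabs_Ropp, Rabs_minus_sym. apply Hord; try easy. lra.
Qed.

(** * Values and lateral limits along the parametrization *)

Lemma Ggen_gamma (gamma : R -> C) (th : nat -> R) (j : nat) (t : R) :
  contour gamma -> 0 <= t < 2 * PI ->
  Ggen gamma th j (gamma t)
    = RtoC ((if Rle_dec t (th j) then 0 else 1) - t / (2 * PI)).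
Proof.
intros Hg Ht. unfold Ggen, Hgen, Rgen. rewrite (angle_gamma _ _ Hg Ht).
destruct (Rle_dec t (th j)); now rewrite RtoC_minus.
Qed.

Lemma Ggen_before (gamma : R -> C) (th : nat -> R) (j : nat) (t : R) :
  contour gamma -> th j < 2 * PI -> 0 <= t <= th j ->
  Ggen gamma th j (gamma t) = RtoC (0 - t / (2 * PI)).
Proof.
intros Hg Hj Ht. rewrite Ggen_gamma by (auto; lra).
destruct (Rle_dec t (th j)); [easy|lra].
Qed.

(** At the cut [Hgen] and [Rgen] both drop by 1, so the affine formula survives up to the next
    passage through t_j, included because values are incoming ones. *)
Lemma Ggen_after (gamma : R -> C) (th : nat -> R) (j : nat) (t : R) :
  contour gamma -> 0 < th j < 2 * PI -> th j < t <= th j + 2 * PI ->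
  Ggen gamma th j (gamma t) = RtoC (1 - t / (2 * PI)).
Proof.
intros Hg Hj Ht. assert (HP := PI_RGT_0).
destruct (Rlt_le_dec t (2 * PI)) as [H|H].
- rewrite Ggen_gamma by (auto; lra). destruct (Rle_dec t (th j)); [lra|easy].
- replace t with (t - 2 * PI + 2 * PI) at 1 by ring.
  rewrite (contour_periodic _ Hg), Ggen_before by (auto; lra).
  f_equal. field. lra.
Qed.

(** The filter is any one finer than the neighbourhoods of [x], which covers [at_left] and
    [at_right] at once. *)
Lemma filterlim_affine (F : (R -> Prop) -> Prop) {FF : Filter F} (x c : R) (f : R -> C) :
  (forall P, locally x P -> F P) ->
  F (fun t => f t = RtoC (c - t / (2 * PI))) ->
  filterlim f F (locally (RtoC (c - x / (2 * PI)))).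
Proof.
intros HF Hf. assert (HP := PI_RGT_0).
apply (filterlim_ext_loc (fun t => RtoC (c - t / (2 * PI)))).
{ revert Hf. apply filter_imp. now intros t ->. }
enough (Cx : filterlim (fun t => RtoC (c - t / (2 * PI))) (locally x)
  (locally (RtoC (c - x / (2 * PI))))) by (intros P HPl; exact (HF _ (Cx P HPl))).
apply filterlim_locally. intros e.
assert (Ca : continuous (fun t => c - t / (2 * PI)) x).
{ apply (ex_derive_continuous (K := R_AbsRing) (V := R_NormedModule)). auto_derive. lra. }
generalize (proj1 (filterlim_locally _ _) Ca e). apply filter_imp.
(* Balls of [C] are products, and both imaginary parts are 0. *)
intros t Ht. split; [exact Ht|apply ball_center].
Qed.

Lemma lim_outgoing_affine (gamma : R -> C) (v : C -> C) (x y c : R) : x < y ->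
  (forall t, x < t < y -> v (gamma t) = RtoC (c - t / (2 * PI))) ->
  lim_outgoing gamma v x (RtoC (c - x / (2 * PI))).
Proof.
intros Hxy H. unfold lim_outgoing.
apply filterlim_affine; [apply within_filter; apply locally_filter| |].
- intros P HPx. now apply filter_le_within.
- assert (Hd : 0 < y - x) by lra.
  exists (mkposreal _ Hd). intros t Ht Hxt. apply H.
  apply (Rabs_def2 (t - x)) in Ht. simpl in Ht. lra.
Qed.

Lemma lim_incoming_affine (gamma : R -> C) (v : C -> C) (x y c : R) : y < x ->
  (forall t, y < t < x -> v (gamma t) = RtoC (c - t / (2 * PI))) ->
  lim_incoming gamma v x (RtoC (c - x / (2 * PI))).
Proof.
intros Hxy H. unfold lim_incoming.
apply filterlim_affine; [apply within_filter; apply locally_filter| |].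
- intros P HPx. now apply filter_le_within.
- assert (Hd : 0 < x - y) by lra.
  exists (mkposreal _ Hd). intros t Ht Hxt. apply H.
  apply (Rabs_def2 (t - x)) in Ht. simpl in Ht. lra.
Qed.

(** * Position of the continuity arcs *)

Lemma disc_nondecreasing (n : nat) (th : nat -> R) (Hth : disc_angles n th) (i j : nat) :
  (1 <= i)%nat -> (i <= j)%nat -> (j <= n)%nat -> th i <= th j.
Proof.
intros Hi Hij Hj. destruct (Nat.eq_dec i j) as [<-|N]; [lra|].
apply Rlt_le, (disc_increasing _ _ Hth); lia.
Qed.

Lemma arc_end_gt (n : nat) (th : nat -> R) (Hth : disc_angles n th) (k : nat) :
  (1 <= k <= n)%nat -> th k < arc_end n th k.
Proof.
intros Hk. unfold arc_end. destruct (Nat.eq_dec k n) as [->|N].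
- assert (H1 := disc_range _ _ Hth 1%nat ltac:(lia)).
  assert (H2 := disc_range _ _ Hth n Hk). lra.
- apply (disc_increasing _ _ Hth); lia.
Qed.

(** Keeps the k-th arc within the period following [th j], the range of [Ggen_after]. *)
Lemma arc_end_le (n : nat) (th : nat -> R) (Hth : disc_angles n th) (k j : nat) :
  (1 <= j <= k)%nat -> (k <= n)%nat -> arc_end n th k <= th j + 2 * PI.
Proof.
intros Hj Hk. unfold arc_end. destruct (Nat.eq_dec k n) as [->|N].
- assert (H := disc_nondecreasing _ _ Hth 1%nat j ltac:(lia) ltac:(lia) ltac:(lia)). lra.
- assert (H1 := disc_range _ _ Hth (S k) ltac:(lia)).
  assert (H2 := disc_range _ _ Hth j ltac:(lia)). lra.
Qed.

(** The strict inequality is what [chord_arc] requires; a lone arc would fill the whole period and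
    its ends would meet. *)
Lemma arc_end_lt (n : nat) (th : nat -> R) (Hth : disc_angles n th) (k : nat) :
  (1 <= k <= n)%nat -> n <> 1%nat -> arc_end n th k - th k < 2 * PI.
Proof.
intros Hk Hn. unfold arc_end. destruct (Nat.eq_dec k n) as [->|N].
- assert (H := disc_increasing _ _ Hth 1%nat n ltac:(lia) ltac:(lia) ltac:(lia)). lra.
- assert (H1 := disc_range _ _ Hth (S k) ltac:(lia)).
  assert (H2 := disc_range _ _ Hth k ltac:(lia)). lra.
Qed.

(** * The generators on the arcs and their jumps *)

(** The constant term of G_j on the k-th arc: arcs from index [j] on follow the jump of H_j. On the
    last arc the parameter runs past 2 PI, so the constant stays 1 beyond the cut. *)
Definition arc_offset (j k : nat) : R := if Compare_dec.le_dec j k then 1 else 0.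

Lemma Ggen_arc (gamma : R -> C) (n : nat) (th : nat -> R)
    (Hg : contour gamma) (Hth : disc_angles n th) (j k : nat) (t : R) :
  (1 <= j <= n)%nat -> (1 <= k <= n)%nat -> th k < t <= arc_end n th k ->
  Ggen gamma th j (gamma t) = RtoC (arc_offset j k - t / (2 * PI)).
Proof.
intros Hj Hk Ht.
assert (Rj := disc_range _ _ Hth j Hj). assert (Rk := disc_range _ _ Hth k Hk).
unfold arc_offset. destruct (Compare_dec.le_dec j k) as [H|H].
- apply Ggen_after; try easy.
  assert (H1 := disc_nondecreasing _ _ Hth j k ltac:(lia) ltac:(lia) ltac:(lia)).
  assert (H2 := arc_end_le _ _ Hth k j ltac:(lia) ltac:(lia)). lra.
- apply Ggen_before; try easy.
  (* Since k < j <= n, this arc does not cross the cut and ends at [th (S k)], at most [th j]. *)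
  unfold arc_end in Ht. destruct (Nat.eq_dec k n); [lia|].
  assert (H1 := disc_nondecreasing _ _ Hth (S k) j ltac:(lia) ltac:(lia) ltac:(lia)). lra.
Qed.

Lemma Ggen_outgoing (gamma : R -> C) (n : nat) (th : nat -> R)
    (Hg : contour gamma) (Hth : disc_angles n th) (j k : nat) :
  (1 <= j <= n)%nat -> (1 <= k <= n)%nat ->
  lim_outgoing gamma (Ggen gamma th j) (th k) (RtoC (arc_offset j k - th k / (2 * PI))).
Proof.
intros Hj Hk.
apply lim_outgoing_affine with (arc_end n th k); [now apply arc_end_gt|].
intros t Ht. apply (Ggen_arc _ n); try easy. lra.
Qed.

Lemma Ggen_incoming_arc_end (gamma : R -> C) (n : nat) (th : nat -> R)
    (Hg : contour gamma) (Hth : disc_angles n th) (j k : nat) :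
  (1 <= j <= n)%nat -> (1 <= k <= n)%nat ->
  lim_incoming gamma (Ggen gamma th j) (arc_end n th k)
    (RtoC (arc_offset j k - arc_end n th k / (2 * PI))).
Proof.
intros Hj Hk.
apply lim_incoming_affine with (th k); [now apply arc_end_gt|].
intros t Ht. apply (Ggen_arc _ n); try easy. lra.
Qed.

Lemma Ggen_incoming (gamma : R -> C) (n : nat) (th : nat -> R)
    (Hg : contour gamma) (Hth : disc_angles n th) (j i : nat) :
  (1 <= j <= n)%nat -> (1 <= i <= n)%nat ->
  lim_incoming gamma (Ggen gamma th j) (th i) (Ggen gamma th j (gamma (th i))).
Proof.
intros Hj Hi.
assert (Rj := disc_range _ _ Hth j Hj). assert (Ri := disc_range _ _ Hth i Hi).
(* The arc ending at t_i has index i - 1, or [n] with a parameter shift when i = 1; comparing [i]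
   with [j] avoids that distinction. *)
destruct (Compare_dec.le_dec i j) as [H|H].
- assert (H1 := disc_nondecreasing _ _ Hth i j ltac:(lia) H ltac:(lia)).
  rewrite Ggen_before by (auto; lra).
  apply lim_incoming_affine with 0; [lra|].
  intros t Ht. apply Ggen_before; auto; lra.
- assert (H1 := disc_increasing _ _ Hth j i ltac:(lia) ltac:(lia) ltac:(lia)).
  rewrite Ggen_after by (auto; lra).
  apply lim_incoming_affine with (th j); [lra|].
  intros t Ht. apply Ggen_after; auto; lra.
Qed.

(** The affine parts cancel, leaving the indicator of [j <= i] minus that of [th j < th i]; by
    monotonicity they disagree only for [i = j], where the first is 1 and the second 0. *)
Lemma Ggen_jump (gamma : R -> C) (n : nat) (th : nat -> R)
    (Hg : contour gamma) (Hth : disc_angles n th) (i j : nat) :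
  (1 <= i <= n)%nat -> (1 <= j <= n)%nat ->
  has_jump gamma (Ggen gamma th j) (th i) (kron i j).
Proof.
intros Hi Hj.
exists (Ggen gamma th j (gamma (th i))), (RtoC (arc_offset j i - th i / (2 * PI))).
split; [now apply (Ggen_incoming _ n)|split; [now apply (Ggen_outgoing _ n)|]].
assert (Ri := disc_range _ _ Hth i Hi).
rewrite Ggen_gamma by (auto; lra). rewrite <- RtoC_minus.
unfold kron, arc_offset.
destruct (Rle_dec (th i) (th j)) as [H|H], (Compare_dec.le_dec j i) as [H'|H'],
  (Nat.eq_dec i j) as [E|E]; try lia; try (f_equal; ring).
- assert (T := disc_increasing _ _ Hth j i ltac:(lia) ltac:(lia) ltac:(lia)). lra.
- subst; lra.
- assert (T := disc_increasing _ _ Hth i j ltac:(lia) ltac:(lia) ltac:(lia)). lra.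
Qed.

(** * Lipschitz continuity away from the jump *)

(** A shift by whole periods puts the parameter interval strictly between two consecutive passages
    through t_j: there G_j is affine and the chord-arc bound is available. *)
Lemma Ggen_lipschitz (gamma : R -> C) (n : nat) (th : nat -> R)
    (Hg : contour gamma) (Hth : disc_angles n th) (j : nat) (A : C -> Prop) :
  (1 <= j <= n)%nat -> closed_subarc gamma A -> ~ A (gamma (th j)) ->
  lipschitz_on A (Ggen gamma th j).
Proof.
intros Hj [a [b [Hab HA]]] Hn. assert (HP := PI_RGT_0).
assert (Rj := disc_range _ _ Hth j Hj).
destruct (shift_into_period (th j) a) as [k Hk].
(* Otherwise the shifted interval contains [th j + 2 * PI], and [A] contains t_j. *)
assert (Hb : b - IZR k * (2 * PI) < th j + 2 * PI).
{ apply Rnot_le_lt. intros Hb. apply Hn, HA.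
  exists (th j + IZR (k + 1) * (2 * PI)).
  rewrite contour_periodic_Z by easy. split; [|easy]. rewrite plus_IZR. lra. }
set (a' := a - IZR k * (2 * PI)) in *. set (b' := b - IZR k * (2 * PI)) in *.
destruct (chord_arc _ Hg a' b') as [c [Hc Hca]]; [lra|].
assert (HA' : forall z, A z -> exists t, a' <= t <= b' /\ z = gamma t).
{ intros z Hz. apply HA in Hz. destruct Hz as [t [Ht ->]].
  exists (t - IZR k * (2 * PI)). split; [unfold a', b'; lra|].
  rewrite <- (contour_periodic_Z _ Hg k (t - IZR k * (2 * PI))). f_equal. ring. }
(* The slope of G_j in absolute value, divided by the chord-arc constant. *)
exists (/ c * / (2 * PI)). intros z w Hz Hw.
destruct (HA' z Hz) as [s [Hs ->]]. destruct (HA' w Hw) as [t [Ht ->]].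
rewrite !Ggen_after by (auto; lra).
rewrite Cmod_RtoC_minus.
replace (1 - s / (2 * PI) - (1 - t / (2 * PI))) with (/ (2 * PI) * - (s - t))
  by (field; lra).
assert (Hi : 0 < / (2 * PI)) by (apply Rinv_0_lt_compat; lra).
rewrite Rabs_mult, Rabs_Ropp, (Rabs_pos_eq (/ (2 * PI))) by lra.
rewrite (Rmult_comm (/ c)), Rmult_assoc. apply Rmult_le_compat_l; [lra|].
apply Rmult_le_reg_l with c; [easy|].
rewrite <- Rmult_assoc, Rinv_r, Rmult_1_l by lra. now apply Hca.
Qed.

(** * Hölder bounds on the completed arcs *)

Lemma arc_dist_lower_bound (gamma : R -> C) (n : nat) (th : nat -> R)
    (Hg : contour gamma) (Hth : disc_angles n th) (k : nat) :
  (1 <= k <= n)%nat ->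
  exists c, 0 < c /\ forall s t,
    th k <= s <= arc_end n th k -> th k <= t <= arc_end n th k ->
    c * Rabs (s - t) <= arc_dist gamma n s t.
Proof.
intros Hk. unfold arc_dist. destruct (Nat.eq_dec n 1) as [E|N].
- apply arc_length_lower_bound; [easy|]. now apply Rlt_le, arc_end_gt.
- apply chord_arc; [easy|]. now apply arc_end_lt.
Qed.

(** For 0 < x <= 1 and sigma < 1, x is at most its power of exponent sigma; the bound x <= d / c and
    monotonicity of powers do the rest. *)
Lemma holder_of_linear_bound (c sigma x d : R) :
  0 < c -> 0 < sigma < 1 -> 0 < x <= 1 -> c * x <= d ->
  x <= Rpower (/ c) sigma * Rpower d sigma.
Proof.
intros Hc Hs Hx Hd.
assert (Hc' := Rinv_0_lt_compat _ Hc).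
assert (Hcx : 0 < c * x) by now apply Rmult_lt_0_compat.
rewrite Rpower_mult_distr by lra.
apply Rle_trans with (Rpower x sigma).
- unfold Rpower. rewrite <- (exp_ln x) at 1 by lra.
  destruct (Rle_lt_or_eq_dec x 1 (proj2 Hx)) as [H1| ->].
  + assert (ln x < 0) by (rewrite <- ln_1; apply ln_increasing; lra).
    apply Rlt_le, exp_increasing. nra.
  + rewrite ln_1, Rmult_0_r. lra.
- apply Rle_Rpower_l; [lra|]. split; [lra|].
  apply Rmult_le_reg_l with c; [easy|].
  rewrite <- Rmult_assoc, Rinv_r, Rmult_1_l by lra. easy.
Qed.

(* The factor [/ (2 * PI)] normalizes parameter differences on an arc to at
   most 1, where the linear bound implies the Hölder one. *)
Lemma arc_holder_bound (gamma : R -> C) (n : nat) (th : nat -> R)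
    (Hg : contour gamma) (Hth : disc_angles n th) (sigma : R) (k : nat) :
  0 < sigma < 1 -> (1 <= k <= n)%nat ->
  exists M, forall s t,
    th k <= s <= arc_end n th k -> th k <= t <= arc_end n th k -> s <> t ->
    Rabs (s - t) / (2 * PI) <= M * Rpower (arc_dist gamma n s t) sigma.
Proof.
intros Hsig Hk. assert (HP := PI_RGT_0).
destruct (arc_dist_lower_bound _ n th Hg Hth k Hk) as [c [Hc H]].
exists (Rpower (/ (c * (2 * PI))) sigma). intros s t Hs Ht N.
assert (Hst : 0 < Rabs (s - t)) by (apply Rabs_pos_lt; lra).
assert (He := arc_end_le _ _ Hth k k ltac:(lia) ltac:(lia)).
assert (Hle : Rabs (s - t) <= 2 * PI) by (apply Rabs_le; lra).
apply holder_of_linear_bound; try easy.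
- apply Rmult_lt_0_compat; lra.
- split; [apply Rdiv_lt_0_compat; lra|].
  apply Rmult_le_reg_r with (2 * PI); [lra|].
  unfold Rdiv. rewrite Rmult_assoc, Rinv_l, Rmult_1_r by lra. lra.
- replace (c * (2 * PI) * (Rabs (s - t) / (2 * PI))) with (c * Rabs (s - t))
    by (field; lra). now apply H.
Qed.

(** Endpoint values are known only as some lateral limit; uniqueness of limits identifies them, so
    one affine formula covers the closed parameter interval. *)
Lemma Ggen_completed_value (gamma : R -> C) (n : nat) (th : nat -> R)
    (Hg : contour gamma) (Hth : disc_angles n th) (j k : nat) (s : R) (l : C) :
  (1 <= j <= n)%nat -> (1 <= k <= n)%nat ->
  completed_value gamma n th (Ggen gamma th j) k s l ->
  th k <= s <= arc_end n th k /\ l = RtoC (arc_offset j k - s / (2 * PI)).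
Proof.
intros Hj Hk H. assert (He := arc_end_gt _ _ Hth k Hk).
destruct H as [[Hs ->]|[[-> Hl]|[-> Hl]]].
- split; [lra|]. apply (Ggen_arc _ n); try easy. lra.
- split; [lra|].
  apply (filterlim_locally_unique (K := R_AbsRing) (V := C_R_NormedModule)
    (F := at_right (th k)) _ _ _ Hl).
  now apply (Ggen_outgoing _ n).
- split; [lra|].
  apply (filterlim_locally_unique (K := R_AbsRing) (V := C_R_NormedModule)
    (F := at_left (arc_end n th k)) _ _ _ Hl).
  now apply Ggen_incoming_arc_end.
Qed.

Lemma Cmod_Ggen_difference (c s t : R) :
  Cmod (Cminus (RtoC (c - s / (2 * PI))) (RtoC (c - t / (2 * PI))))
    = Rabs (s - t) / (2 * PI).
Proof.
assert (HP := PI_RGT_0). rewrite Cmod_RtoC_minus.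
replace (c - s / (2 * PI) - (c - t / (2 * PI))) with (- ((s - t) / (2 * PI)))
  by (field; lra).
rewrite Rabs_Ropp, Rabs_div by lra. now rewrite (Rabs_pos_eq (2 * PI)) by lra.
Qed.

(** * Finiteness of the norm and membership in X_sigma *)

(** The member excludes -oo, the upper bound +oo. *)
Lemma Lub_Rbar_finite (E : R -> Prop) (x M : R) :
  E x -> (forall y, E y -> y <= M) -> is_finite (Lub_Rbar E).
Proof.
intros Hx HM. destruct (Lub_Rbar_correct E) as [Hub Hlub].
specialize (Hub x Hx). specialize (Hlub (Finite M) HM).
destruct (Lub_Rbar E); simpl in *; easy.
Qed.

Lemma Rbar_lub_finite (E : Rbar -> Prop) (x M : R) :
  E (Finite x) -> (forall y, E y -> Rbar_le y (Finite M)) -> is_finite (Rbar_lub E).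
Proof.
intros Hx HM.
destruct (proj2_sig (Rbar_ex_lub E)) as [Hub Hlub]. fold (Rbar_lub E) in *.
specialize (Hub _ Hx). specialize (Hlub (Finite M) HM).
destruct (Rbar_lub E); simpl in *; easy.
Qed.

(** Turns bounds arc by arc into one for the norm: by monotonicity the larger of two bounds serves
    for both. *)
Lemma uniform_bound (n : nat) (f : nat -> R -> Prop) :
  (forall k M M', f k M -> M <= M' -> f k M') ->
  (forall k, (1 <= k <= n)%nat -> exists M, f k M) ->
  exists M, forall k, (1 <= k <= n)%nat -> f k M.
Proof.
intros Hmono. induction n as [|n IH]; intros H.
- exists 0. lia.
- destruct IH as [M HM]. { intros k Hk. apply H. lia. }
  destruct (H (S n)) as [M' HM']; [lia|].
  exists (Rmax M M'). intros k Hk. destruct (Nat.eq_dec k (S n)) as [->|N].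
  + apply Hmono with M'; [easy|apply Rmax_r].
  + apply Hmono with M; [apply HM; lia|apply Rmax_l].
Qed.

Lemma Ggen_arc_norm (gamma : R -> C) (n : nat) (th : nat -> R)
    (Hg : contour gamma) (Hth : disc_angles n th) (sigma : R) (j k : nat) :
  0 < sigma < 1 -> (1 <= j <= n)%nat -> (1 <= k <= n)%nat ->
  exists x : R, Rbar_plus (arc_sup gamma n th (Ggen gamma th j) k)
    (arc_holder gamma n th sigma (Ggen gamma th j) k) = Finite x.
Proof.
intros Hsig Hj Hk. assert (HP := PI_RGT_0).
assert (He := arc_end_gt _ _ Hth k Hk).
assert (Hle := arc_end_le _ _ Hth k k ltac:(lia) ltac:(lia)).
assert (Rk := disc_range _ _ Hth k Hk).
set (e := arc_end n th k) in *.
assert (Hmid : forall s, th k < s < e ->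
  completed_value gamma n th (Ggen gamma th j) k s (Ggen gamma th j (gamma s))).
{ intros s Hs. now left. }
(* Two distinct interior points, showing that the sets under both suprema are inhabited. *)
set (s1 := (2 * th k + e) / 3). set (s2 := (th k + 2 * e) / 3).
assert (Hs1 : th k < s1 < e) by (unfold s1; lra).
assert (Hs2 : th k < s2 < e) by (unfold s2; lra).
assert (F1 : is_finite (arc_sup gamma n th (Ggen gamma th j) k)).
(* The arc lies in (0, 4 PI), so [s / (2 * PI)] is at most 2 and the modulus too; 3 leaves slack. *)
{ eapply Lub_Rbar_finite with (M := 3).
  - exists s1. eexists. split; [now apply Hmid|reflexivity].
  - intros x [s [l [Hv ->]]].
    destruct (Ggen_completed_value _ n th Hg Hth j k s l Hj Hk Hv) as [Hs ->].
    fold e in Hs. rewrite Cmod_R.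
    assert (E : s / (2 * PI) * (2 * PI) = s) by (field; lra).
    set (q := s / (2 * PI)) in *.
    assert (0 <= q <= 2) by (split; nra).
    unfold arc_offset. destruct (Compare_dec.le_dec j k); apply Rabs_le; lra. }
assert (F2 : is_finite (arc_holder gamma n th sigma (Ggen gamma th j) k)).
{ destruct (arc_holder_bound _ n th Hg Hth sigma k Hsig Hk) as [M HM].
  eapply Lub_Rbar_finite with (M := M).
  - exists s1, s2. do 2 eexists.
    split; [now apply Hmid|split; [now apply Hmid|split; [unfold s1, s2; lra|reflexivity]]].
  - intros x [s [t [ls [lt [Hvs [Hvt [N ->]]]]]]].
    destruct (Ggen_completed_value _ n th Hg Hth j k s ls Hj Hk Hvs) as [Hs ->].
    destruct (Ggen_completed_value _ n th Hg Hth j k t lt Hj Hk Hvt) as [Ht ->].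
    rewrite Cmod_Ggen_difference.
    (* [Rpower] is an exponential, hence positive whatever its base. *)
    assert (Hp : 0 < Rpower (arc_dist gamma n s t) sigma) by apply exp_pos.
    apply Rmult_le_reg_r with (1 := Hp).
    unfold Rdiv at 1. rewrite Rmult_assoc, Rinv_l, Rmult_1_r by lra.
    now apply HM. }
(* [is_finite] is an equation, so rewriting with it exhibits a sum of two reals. *)
rewrite <- F1, <- F2. simpl. eauto.
Qed.

Lemma Ggen_PH_norm_finite (gamma : R -> C) (n : nat) (th : nat -> R)
    (Hg : contour gamma) (Hth : disc_angles n th) (sigma : R) (j : nat) :
  0 < sigma < 1 -> (1 <= j <= n)%nat ->
  is_finite (PH_norm gamma n th sigma (Ggen gamma th j)).
Proof.
intros Hsig Hj.
assert (H := fun k => Ggen_arc_norm _ n th Hg Hth sigma j k Hsig Hj).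
destruct (uniform_bound n (fun k M => Rbar_le
    (Rbar_plus (arc_sup gamma n th (Ggen gamma th j) k)
      (arc_holder gamma n th sigma (Ggen gamma th j) k)) (Finite M))) as [M HM].
- intros k M M' HM HMM'. now apply Rbar_le_trans with (Finite M).
- intros k Hk. destruct (H k Hk) as [x Hx]. exists x. rewrite Hx. apply Rbar_le_refl.
- destruct (H j Hj) as [x Hx].
  apply Rbar_lub_finite with x M.
  + exists j. now split.
  + intros y [k [Hk ->]]. now apply HM.
Qed.

Lemma Ggen_in_PH (gamma : R -> C) (n : nat) (th : nat -> R)
    (Hg : contour gamma) (Hth : disc_angles n th) (sigma : R) (j : nat) :
  0 < sigma < 1 -> (1 <= j <= n)%nat -> in_PH gamma n th sigma (Ggen gamma th j).
Proof.
intros Hsig Hj. split.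
- intros k Hk. destruct (arc_holder_bound _ n th Hg Hth sigma k Hsig Hk) as [M HM].
  exists M. intros s t Hs Ht N.
  rewrite (Ggen_arc _ n th Hg Hth j k s), (Ggen_arc _ n th Hg Hth j k t) by (easy || lra).
  rewrite Cmod_Ggen_difference. apply HM; try easy; lra.
- intros i Hi. now apply (Ggen_incoming _ n).
- intros i Hi. eexists. now apply (Ggen_outgoing _ n).
- now apply Ggen_PH_norm_finite.
Qed.

Theorem lemma5p1 (gamma : R -> C) (n : nat) (th : nat -> R)
    (Hgamma : contour gamma) (Hth : disc_angles n th) :
  (forall i j : nat, (1 <= i <= n)%nat -> (1 <= j <= n)%nat ->
     has_jump gamma (Ggen gamma th j) (th i) (kron i j)) /\
  (forall j : nat, (1 <= j <= n)%nat ->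
     (forall A : C -> Prop,
        closed_subarc gamma A -> ~ A (gamma (th j)) ->
        lipschitz_on A (Ggen gamma th j)) /\
     (forall sigma : R, 0 < sigma < 1 ->
        in_PH gamma n th sigma (Ggen gamma th j))).
Proof.
split.
- intros i j Hi Hj. now apply (Ggen_jump _ n).
- intros j Hj. split.
  + intros A. now apply (Ggen_lipschitz _ n).
  + intros sigma Hsig. now apply Ggen_in_PH.
Qed.
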